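(* Every computable random function is arithmetical: for every $m$ and every random function $f:\mathbb{N}^m\to\mathcal{D}(\mathbb{N})$ computed by some (Gill) probabilistic Turing machine, there is an $\mathsf{MQPA}$ formula $F_f$ with free variables $x_1,\dots,x_m,y$ such that for all $n_1,\dots,n_m,l\in\mathbb{N}$, $\mu([\![F_f(n_1,\dots,n_m,l)]\!])=f(n_1,\dots,n_m)(l)$.
   Context: $\mathcal{D}(\mathbb{N})$ is the set of pseudo-distributions on $\mathbb{N}$, i.e. functions $d:\mathbb{N}\to[0,1]$ with $\sum_n d(n)\le1$. A random function is a function $\mathbb{N}^m\to\mathcal{D}(\mathbb{N})$. A (Gill) probabilistic Turing machine is a Turing machine whose transition function assigns to each non-final state and scanned symbol two possible transition steps, each chosen with probability $1/2$ independently at each step; the random function it computes maps $(n_1,\dots,n_m)$ to the pseudo-distribution giving, for each $l$, the probability that the machine on input (an encoding of) $(n_1,\dots,n_m)$ halts with output (an encoding of) $l$. A random function is computable if it is computed by such a machine. Measure-theoretic setting: $\mathbb{B}=\{0,1\}$; for $X\subseteq\mathbb{B}^n$, $\mathrm{Cyl}(X)=\{s\cdot\omega\mid s\in X,\omega\in\mathbb{B}^{\mathbb{N}}\}$; $\mu$ is the probability measure on the $\sigma$-algebra generated by cylinders with $\mu(\mathrm{Cyl}(X))=|X|/2^n$. $\mathsf{MQPA}$ terms: $t,s::=x\mid0\mid S(t)\mid t+s\mid t\times s$; formulas: $F,G::=\mathsf{FLIP}(t)\mid t=s\mid\neg F\mid F\vee G\mid F\wedge G\mid\exists x.F\mid\forall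 x.F\mid\mathbf{C}^{t/s}F\mid\mathbf{D}^{t/s}F$. With environment $\xi$ and usual term interpretation $[\![t]\!]_\xi$, formulas denote measurable subsets of $\mathbb{B}^{\mathbb{N}}$: $[\![\mathsf{FLIP}(t)]\!]_\xi=\{\omega\mid\omega([\![t]\!]_\xi)=1\}$; $[\![t=s]\!]_\xi$ is $\mathbb{B}^{\mathbb{N}}$ if $[\![t]\!]_\xi=[\![s]\!]_\xi$ and $\emptyset$ otherwise; $\neg,\vee,\wedge$ are complement, union, intersection; $\exists x$ / $\forall x$ are the union / intersection over $i\in\mathbb{N}$ of $[\![G]\!]_{\xi\{x\leftarrow i\}}$; $[\![\mathbf{C}^{t/s}G]\!]_\xi=\mathbb{B}^{\mathbb{N}}$ if $[\![s]\!]_\xi>0$ and $\mu([\![G]\!]_\xi)\ge[\![t]\!]_\xi/[\![s]\!]_\xi$, else $\emptyset$; $[\![\mathbf{D}^{t/s}G]\!]_\xi=\mathbb{B}^{\mathbb{N}}$ if $[\![s]\!]_\xi=0$ or $\mu([\![G]\!]_\xi)<[\![t]\!]_\xi/[\![s]\!]_\xi$, else $\emptyset$. $F_f(n_1,\dots,n_m,l)$ denotes $F_f$ with the free variables instantiated by the numerals of $n_1,\dots,n_m,l$. *)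

(* Defs.v *)
From HB Require Import structures.
From mathcomp Require Import all_boot all_order all_algebra.
From mathcomp Require Import all_classical all_reals all_analysis.
From mathcomp Require Import zify.
Set Implicit Arguments.
Unset Strict Implicit.
Unset Printing Implicit Defensive.
Import Order.TTheory GRing.Theory Num.Theory.
Local Open Scope classical_set_scope.
Local Open Scope ring_scope.

(* [nth] falls back on its default exactly beyond the end of [s]. *)
Definition catstream (s : seq bool) (w : nat -> bool) : nat -> bool :=
  fun i => nth (w (i - size s)%N) s i.

Definition Cyl n (X : {set n.-tuple bool}) : set (nat -> bool) :=
  [set w | exists s : n.-tuple bool, exists w', s \in X /\ w = catstream s w'].

Definition cylinders : set (set (nat -> bool)) :=
  [set A | exists n (X : {set n.-tuple bool}), A = Cyl X].

Notation bitstream := (g_sigma_algebraType cylinders).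

(* These values determine [mu], cylinders being closed under intersection;
   [coin_measure_exists] below provides such a [mu]. *)
Definition is_coin_measure (R : realType) (mu : probability bitstream R) :=
  forall n (X : {set n.-tuple bool}), mu (Cyl X) = (#|X|%:R / 2 ^+ n)%:E.

Record pseudo_distr (R : realType) := PseudoDistr {
  pd_val :> nat -> R;
  pd_itv : forall n, 0 <= pd_val n <= 1;
  pd_sum : (\sum_(0 <= n <oo) (pd_val n)%:E <= 1)%E }.

Definition random_function (R : realType) m := m.-tuple nat -> pseudo_distr R.

Inductive move := MoveLeft | Stay | MoveRight.

(* A one-tape machine, the tape being infinite in both directions.  The two
   components of [ptm_trans q a] are the two possible steps; they are never
   used when [q] is final. *)
Record ptm := Ptm {
  ptm_state : finType;
  ptm_symbol : finType;
  ptm_start : ptm_state;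
  ptm_final : {set ptm_state};
  ptm_blank : ptm_symbol;
  ptm_bit : bool -> ptm_symbol;
  ptm_bit_inj : injective ptm_bit;
  ptm_bit_nblank : forall b, ptm_bit b != ptm_blank;
  ptm_trans : ptm_state -> ptm_symbol ->
    (ptm_state * ptm_symbol * move) * (ptm_state * ptm_symbol * move) }.

(* [cfg_left] lists the cells on the left of the head, nearest first, and
   [cfg_right] those on its right, nearest first; all cells beyond either list
   are blank. *)
Record config (M : ptm) := Config {
  cfg_state : ptm_state M;
  cfg_left : seq (ptm_symbol M);
  cfg_head : ptm_symbol M;
  cfg_right : seq (ptm_symbol M) }.

Definition apply_step M (s : ptm_state M * ptm_symbol M * move) (c : config M)
    : config M :=
  let: (q, a, d) := s in
  let: Config _ l _ r := c in
  match d with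
  | MoveLeft => Config q (behead l) (head (ptm_blank M) l) (a :: r)
  | Stay => Config q l a r
  | MoveRight => Config q (a :: l) (head (ptm_blank M) r) (behead r)
  end.

Definition is_final M (c : config M) : bool := cfg_state c \in ptm_final M.

Definition step M (b : bool) (c : config M) : config M :=
  if is_final c then c
  else let p := ptm_trans (cfg_state c) (cfg_head c) in
       apply_step (if b then p.2 else p.1) c.

(* Unary code: [(n_1, ..., n_m)] is encoded by [1^n_1 0 ... 1^n_m 0], and the
   output [l] is encoded as the one-component tuple [(l)]. *)
Definition encode (ns : seq nat) : seq bool :=
  flatten [seq rcons (nseq n true) false | n <- ns].

Definition init_config M (ns : seq nat) : config M :=
  let w := map (@ptm_bit M) (encode ns) in
  Config (ptm_start M) [::] (head (ptm_blank M) w) (behead w).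

(* The word read from the head rightwards, up to the first blank. *)
Definition output_word M (c : config M) : seq (ptm_symbol M) :=
  let w := cfg_head c :: cfg_right c in take (index (ptm_blank M) w) w.

(* Step number [t] follows the coin [w t]; under the coin measure these are
   independent and fair. *)
Fixpoint run M (ns : seq nat) (w : nat -> bool) (t : nat) : config M :=
  if t is t'.+1 then step (w t') (run M ns w t') else init_config M ns.

Definition halts_with M (ns : seq nat) (l : nat) : set bitstream :=
  [set w | exists t, is_final (run M ns w t) /\
             output_word (run M ns w t) = map (@ptm_bit M) (encode [:: l])].

Definition computes (R : realType) (mu : probability bitstream R) m
    (M : ptm) (f : random_function R m) : Prop :=
  forall (ns : m.-tuple nat) (l : nat), (f ns l)%:E = mu (halts_with M ns l).

Definition computable (R : realType) (mu : probability bitstream R) m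
    (f : random_function R m) : Prop :=
  exists M : ptm, computes mu M f.

Inductive term :=
| TVar of nat
| TZero
| TSucc of term
| TAdd of term & term
| TMul of term & term.

(* [FC t s F] and [FD t s F] are the measure quantifiers C^{t/s} F and
   D^{t/s} F. *)
Inductive formula :=
| FFlip of term
| FEq of term & term
| FNot of formula
| FOr of formula & formula
| FAnd of formula & formula
| FEx of nat & formula
| FAll of nat & formula
| FC of term & term & formula
| FD of term & term & formula.

Fixpoint teval (xi : nat -> nat) (t : term) : nat :=
  match t with
  | TVar x => xi x
  | TZero => 0
  | TSucc t => (teval xi t).+1
  | TAdd t s => teval xi t + teval xi s
  | TMul t s => teval xi t * teval xi s
  end%N.

Fixpoint interp (R : realType) (mu : probability bitstream R)
    (xi : nat -> nat) (F : formula) : set bitstream :=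
  match F with
  | FFlip t => [set w | w (teval xi t) = true]
  | FEq t s => [set _ | teval xi t = teval xi s]
  | FNot G => ~` interp mu xi G
  | FOr G H => interp mu xi G `|` interp mu xi H
  | FAnd G H => interp mu xi G `&` interp mu xi H
  | FEx x G => \bigcup_(i : nat) interp mu [eta xi with x |-> i] G
  | FAll x G => \bigcap_(i : nat) interp mu [eta xi with x |-> i] G
  | FC t s G => [set _ | (0 < teval xi s)%N /\
      (((teval xi t)%:R / (teval xi s)%:R)%:E <= mu (interp mu xi G))%E]
  | FD t s G => [set _ | teval xi s = 0%N \/
      (mu (interp mu xi G) < ((teval xi t)%:R / (teval xi s)%:R)%:E)%E]
  end.

Fixpoint tfv (t : term) : seq nat :=
  match t with
  | TVar x => [:: x]
  | TZero => [::]
  | TSucc t => tfv t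
  | TAdd t s | TMul t s => tfv t ++ tfv s
  end.

Fixpoint fv (F : formula) : seq nat :=
  match F with
  | FFlip t => tfv t
  | FEq t s => tfv t ++ tfv s
  | FNot G => fv G
  | FOr G H | FAnd G H => fv G ++ fv H
  | FEx x G | FAll x G => [seq y <- fv G | y != x]
  | FC t s G | FD t s G => tfv t ++ tfv s ++ fv G
  end.

Definition numeral (n : nat) : term := iter n TSucc TZero.

Fixpoint tsubst (x : nat) (u t : term) : term :=
  match t with
  | TVar y => if y == x then u else TVar y
  | TZero => TZero
  | TSucc t => TSucc (tsubst x u t)
  | TAdd t s => TAdd (tsubst x u t) (tsubst x u s)
  | TMul t s => TMul (tsubst x u t) (tsubst x u s)
  end.

(* Bound variables are not renamed, so [u] is meant to be closed. *)
Fixpoint fsubst (x : nat) (u : term) (F : formula) : formula :=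
  match F with
  | FFlip t => FFlip (tsubst x u t)
  | FEq t s => FEq (tsubst x u t) (tsubst x u s)
  | FNot G => FNot (fsubst x u G)
  | FOr G H => FOr (fsubst x u G) (fsubst x u H)
  | FAnd G H => FAnd (fsubst x u G) (fsubst x u H)
  | FEx y G => FEx y (if y == x then G else fsubst x u G)
  | FAll y G => FAll y (if y == x then G else fsubst x u G)
  | FC t s G => FC (tsubst x u t) (tsubst x u s) (fsubst x u G)
  | FD t s G => FD (tsubst x u t) (tsubst x u s) (fsubst x u G)
  end.

(* The variables [0, ..., size ns - 1] are replaced by the numerals of [ns]. *)
Definition instantiate (F : formula) (ns : seq nat) : formula :=
  foldl (fun G p => fsubst p.1 (numeral p.2) G) F (zip (iota 0 (size ns)) ns).

Lemma CylE n (X : {set n.-tuple bool}) :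
  Cyl X = [set w | [tuple w (val i) | i < n] \in X].
Proof.
apply/seteqP; split=> w /=.
  move=> [s [w' [sX ->]]].
  suff -> : [tuple catstream s w' (val i) | i < n] = s by [].
  apply: eq_from_tnth => i; rewrite tnth_mktuple (tnth_nth false) /catstream.
  by apply: set_nth_default; rewrite size_tuple ltn_ord.
move=> wX; exists [tuple w (val i) | i < n], (fun i => w (n + i)%N); split=> //.
apply/funext => i; rewrite /catstream size_tuple; case: (ltnP i n) => ni.
  by rewrite (nth_mktuple _ _ (Ordinal ni)).
by rewrite nth_default ?size_tuple // subnKC.
Qed.

Lemma measurable_Cyl n (X : {set n.-tuple bool}) :
  measurable (Cyl X : set bitstream).
Proof. by apply: sub_sigma_algebra; exists n, X. Qed.

Lemma measurable_prefix n (A : set bitstream) :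
  (forall w w' : nat -> bool, (forall i, (i < n)%N -> w i = w' i) ->
     A w -> A w') ->
  measurable A.
Proof.
move=> HA.
suff -> : A = Cyl [set s : n.-tuple bool | `[< A (nth false s) >]]%SET.
  exact: measurable_Cyl.
rewrite CylE; apply/seteqP; split=> w /=; rewrite inE => Aw.
  apply/asboolP; apply: HA Aw => i ni.
  by rewrite (nth_mktuple _ _ (Ordinal ni)).
move/asboolP: Aw; apply: HA => i ni.
by rewrite (nth_mktuple _ _ (Ordinal ni)).
Qed.

Lemma measurable_interp (R : realType) (mu : probability bitstream R) xi F :
  measurable (interp mu xi F).
Proof.
have mcst (P : Prop) : measurable ([set _ | P] : set bitstream).
  by apply: (@measurable_prefix 0%N).
elim: F xi => [t|t s|G IG|G IG H IH|G IG H IH|x G IG|x G IG|t s G IG|t s G IG] xi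
  /=; try exact: mcst.
- by apply: (@measurable_prefix (teval xi t).+1) => w w' e /= <-; rewrite e.
- exact: measurableC.
- exact: measurableU.
- exact: measurableI.
- by apply: bigcupT_measurable.
- by apply: bigcapT_measurable.
Qed.

Lemma measurable_halts_with M ns l : measurable (halts_with M ns l).
Proof.
rewrite (_ : halts_with M ns l = \bigcup_t [set w | is_final (run M ns w t) /\
    output_word (run M ns w t) = map (@ptm_bit M) (encode [:: l])]).
  apply: bigcupT_measurable => t; apply: (@measurable_prefix t) => w w' e /=.
  suff -> : run M ns w t = run M ns w' t by [].
  elim: t e => //= t IHt e; rewrite e// IHt// => i it.
  by apply: e; apply: ltnW.
by apply/seteqP; split=> w [t] => [|_] H; exists t.
Qed.

Lemma output_inj M (c : config M) l l' :
  output_word c = map (@ptm_bit M) (encode [:: l]) ->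
  output_word c = map (@ptm_bit M) (encode [:: l']) -> l = l'.
Proof.
move=> -> /(inj_map (@ptm_bit_inj M)); rewrite /encode /= !cats0.
by move/(congr1 size); rewrite !size_rcons !size_nseq => -[].
Qed.

(* The binary digits of a uniform point of [0, 1[. *)
Section coin_measure_exists.
Variable R : realType.

Let digit (x : R) (i : nat) : bool := odd (Num.truncn (x * 2 ^+ i.+1)).

Let dval (w : nat -> bool) : nat -> nat :=
  fix dval n := if n is k.+1 then ((dval k).*2 + w k)%N else 0%N.

Let dval_lt w n : (dval w n < 2 ^ n)%N.
Proof. by elim: n => //= n IHn; rewrite expnS; case: (w n); lia. Qed.

Let dval_inj w w' n : (dval w n = dval w' n) <->
  (forall i, (i < n)%N -> w i = w' i).
Proof.
elim: n => [|n IHn]; first by split.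
split=> [/= e|e /=].
  have [e1 e2] : dval w n = dval w' n /\ w n = w' n.
    by move: e; case: (w n); case: (w' n); lia.
  move=> i; rewrite ltnS leq_eqVlt => /orP[/eqP -> //|].
  by move/IHn: e1; apply.
by rewrite (e n)// (proj2 IHn)// => i ni; apply: e; apply: ltnW.
Qed.

Let dval_digit (x : R) n : 0 <= x < 1 -> dval (digit x) n = Num.truncn (x * 2 ^+ n).
Proof.
move=> /andP[x0 x1].
elim: n => [|n IHn].
  by rewrite expr0 mulr1 /=; apply/esym/truncn_def; rewrite x0.
rewrite /= IHn /digit.
set k := Num.truncn (x * 2 ^+ n.+1).
suff -> : Num.truncn (x * 2 ^+ n) = k./2 by rewrite addnC odd_double_half.
have p0 m : 0 <= x * 2 ^+ m by rewrite mulr_ge0// exprn_ge0.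
have /andP[k1 k2] := truncn_itv (p0 n.+1).
have xE : x * 2 ^+ n.+1 = (x * 2 ^+ n) * 2 by rewrite exprSr mulrA.
apply: truncn_def; apply/andP; split.
  rewrite -(@ler_pM2r _ 2)// -xE -natrM (le_trans _ k1)// ler_nat; lia.
rewrite -(@ltr_pM2r _ 2)// -xE -natrM (lt_le_trans k2)// ler_nat; lia.
Qed.

Let measurable_truncn_ge n k :
  measurable [set x : R | (k <= Num.truncn (x * 2 ^+ n))%N].
Proof.
case: k => [|k]; first by rewrite (_ : [set _ | _] = setT)//; apply/seteqP.
rewrite (_ : [set _ | _] = `[k.+1%:R / 2 ^+ n, +oo[%classic)//.
by apply/seteqP; split=> x /=; rewrite truncn_gt_nat in_itv /= andbT
  ler_pdivrMr// exprn_gt0.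
Qed.

Let measurable_digit i (b : bool) : measurable [set x : R | digit x i = b].
Proof.
rewrite (_ : [set _ | _] = \bigcup_(k in [set k | odd k = b])
  ([set x : R | (k <= Num.truncn (x * 2 ^+ i.+1))%N] `\`
   [set x : R | (k.+1 <= Num.truncn (x * 2 ^+ i.+1))%N])).
  by apply: bigcup_measurable => k _; apply: measurableD.
apply/seteqP; split=> [x /= <-|x [k /= <-] [/= h /negP]].
  by exists (Num.truncn (x * 2 ^+ i.+1)) => //; split => //=; rewrite ltnn.
rewrite -leqNgt => h'; rewrite /digit; congr odd; apply/eqP.
by rewrite eqn_leq h h'.
Qed.

Let digitb (x : measurableTypeR R) : bitstream := digit x.

Let measurable_digitb : measurable_fun setT digitb.
Proof.
apply: (@measurability _ _ _ _ setT digitb cylinders) => //.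
move=> _ [_ [n [X ->]] <-]; rewrite setTI CylE.
rewrite (_ : _ @^-1` _ = \bigcup_(s in [set s | s \in X])
  \bigcap_(i in `I_n) [set x | digit x i = nth false s i]).
  apply: fin_bigcup_measurable => [|s _]; first exact: finite_finset.
  by apply: bigcap_measurableType => i _; apply: measurable_digit.
apply/seteqP; split=> [x xX|x [s /= sX h]].
  exists [tuple digit x i | i < n] => //= i ni.
  by rewrite (nth_mktuple _ _ (Ordinal ni)).
rewrite /preimage/= (_ : [tuple _ | _ < _] = s)//.
apply: eq_from_tnth => i; rewrite tnth_mktuple (tnth_nth false).
exact: h (ltn_ord i).
Qed.

HB.instance Definition _ := isMeasurableFun.Build _ _ _ _ digitb
  measurable_digitb.

Let P : probability (measurableTypeR R) R := uniform_prob (@ltr01 R).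

Let P_itv (a b : R) : 0 <= a -> a <= b -> b <= 1 -> P `[a, b[%classic = (b - a)%:E.
Proof.
move=> a0 ab b1; rewrite /P /= /uniform_prob integral_uniform_pdf setIidl.
  rewrite (eq_integral (fun=> 1%E)).
    rewrite integral_cst//= mul1e lebesgue_measure_itv/= lte_fin EFinB.
    case: ltgtP ab => // -> _; by rewrite subee.
  move=> x; rewrite inE/= in_itv/= => /andP[ax xb].
  by rewrite /uniform_pdf subr0 invr1 (le_trans a0)//= (le_trans (ltW xb)).
move=> x /=; rewrite !in_itv/= => /andP[ax xb].
by rewrite (le_trans a0)//= (le_trans (ltW xb)).
Qed.

Let P_setI A : measurable A -> P A = P (A `&` `[0, 1[%classic).
Proof.
move=> mA; rewrite (measureDI P mA (measurable_itv `[0, 1[)) [X in (X + _)%E](_ : _ = 0%E) ?add0e//.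
have P1 : P (~` `[0, 1[%classic) = 0%E.
  rewrite probability_setC; last exact: measurable_itv.
  by rewrite P_itv// subr0 subee.
apply/eqP; rewrite eq_le measure_ge0 andbT -P1.
apply: le_measure; rewrite ?inE; [exact: measurableD|exact: measurableC|by move=> x []].
Qed.

Lemma coin_measure_exists :
  exists mu : probability bitstream R, is_coin_measure mu.
Proof.
exists (distribution P digitb) => n X.
have key (s : n.-tuple bool) :
    distribution P digitb (Cyl [set s]%SET) = (1 / 2 ^+ n)%:E.
  rewrite /distribution /pushforward P_setI; last first.
    rewrite -[X in measurable X]setTI; apply: measurable_digitb => //.
    exact: measurable_Cyl.
  pose k := dval (nth false s) n.
  have p0 : (0 : R) < 2 ^+ n by rewrite exprn_gt0.
  rewrite (_ : _ `&` _ = `[k%:R / 2 ^+ n, k.+1%:R / 2 ^+ n[%classic).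
    rewrite P_itv.
    - by rewrite -mulrBl -natrB// subSnn.
    - by rewrite divr_ge0// ltW.
    - by rewrite ler_pM2r ?invr_gt0// ler_nat.
    - by rewrite ler_pdivrMr// mul1r -natrX ler_nat; apply: dval_lt.
  rewrite CylE; apply/seteqP; split=> x /=; rewrite !in_itv /=.
    rewrite inE => -[/eqP sE x01].
    have : dval (digit x) n = k.
      apply/dval_inj => i ni.
      by rewrite -sE (nth_mktuple _ _ (Ordinal ni)).
    rewrite dval_digit// => <-.
    have x0 : 0 <= x * 2 ^+ n by case/andP: x01 => ? _; rewrite mulr_ge0// ltW.
    by have := truncn_itv x0; rewrite ler_pdivrMr// ltr_pdivlMr.
  rewrite ler_pdivrMr// ltr_pdivlMr// => kx.
  have x0 : 0 <= x.
    by case/andP: kx => kx _; rewrite -(pmulr_lge0 _ p0) (le_trans _ kx).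
  have x1 : x < 1.
    case/andP: kx => _ kx; rewrite -(ltr_pM2r p0) mul1r.
    by rewrite (lt_le_trans kx)// -natrX ler_nat; apply: dval_lt.
  rewrite x0 x1; split=> //; rewrite inE; apply/eqP.
  have /dval_inj e : dval (digit x) n = k.
    by rewrite dval_digit ?x0//; apply: truncn_def.
  by apply: eq_from_tnth => i; rewrite tnth_mktuple (tnth_nth false) -e.
have CylU : (Cyl X : set bitstream) =
    \bigcup_(s in [set` enum X]) Cyl [set s]%SET.
  apply/seteqP; split=> w; rewrite CylE /=.
    by move=> wX; exists [tuple w (val i) | i < n]; rewrite /= ?mem_enum// CylE /= inE.
  by move=> [s /=]; rewrite mem_enum => sX; rewrite CylE /= inE => /eqP ->.
rewrite CylU measure_fin_bigcup.
- rewrite -fsbig_seq ?enum_uniq// (eq_bigr (fun=> (1 / 2 ^+ n)%:E)) => [|s _].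
    rewrite big_enum/= sumEFin sumr_const mul1r.
    by congr EFin; exact: esym (mulr_natl _ _).
  exact: key.
- exact: finite_finset.
- move=> s t _ _ [w]; rewrite !CylE /= !inE => -[/eqP <- /eqP <-] //.
- by move=> s _; apply: measurable_Cyl.
Qed.

End coin_measure_exists.

(* Main.v *)
Require Import Defs.
From HB Require Import structures.
From mathcomp Require Import all_boot all_order all_algebra.
From mathcomp Require Import all_classical all_reals all_analysis.
From mathcomp Require Import zify.

(* The event "M halts with output l" is itself the denotation of a formula,
   whatever the measure: FLIP serves as an oracle for the coins, the tape halves
   are numbers in a base large enough for the alphabet, and a run of M, being a
   finite sequence of codes of configurations, is a pair of numbers by Goedel's
   beta function. *)

Set Implicit Arguments.
Unset Strict Implicit.
Unset Printing Implicit Defensive.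
Import Order.TTheory GRing.Theory Num.Theory.
Local Open Scope classical_set_scope.
Local Open Scope ring_scope.

(** * Goedel's beta function and a pairing function *)

Section Beta.
Local Open Scope nat_scope.

(** Induction on [n]: the new residue is adjoined by the theorem for two moduli, [d n] being coprime
    to the product of the earlier ones. *)
Lemma chinese_seq (d u : nat -> nat) n :
  (forall i j, i < j < n -> coprime (d i) (d j)) ->
  exists a, forall i, i < n -> a = u i %[mod d i].
Proof.
elim: n => [|n IHn] co; first by exists 0.
have [|a aP] := IHn.
  by move=> i j /andP[ij jn]; apply: co; rewrite ij ltnW.
have co_n : coprime (\prod_(i < n) d i) (d n).
  rewrite coprime_sym; elim/big_ind: _ => [|x y cx cy|i _].
  - exact: coprimen1.
  - by rewrite coprimeMr cx.
  - by rewrite coprime_sym co// ltn_ord leqnn.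
exists (chinese (\prod_(i < n) d i) (d n) a (u n)) => i.
rewrite ltnS leq_eqVlt => /orP[/eqP ->|lt_in]; first exact: chinese_modr.
have dvd_i : d i %| \prod_(i < n) d i.
  by rewrite (bigD1 (Ordinal lt_in))//= dvdn_mulr.
by rewrite -(modn_dvdm _ dvd_i) chinese_modl// modn_dvdm// aP.
Qed.

Definition beta a b i := a %% (i.+1 * b).+1.

(** Take for [b] the factorial of some [N] bounding [n] and all the [u i]: the moduli are then
    pairwise coprime and exceed every [u i], so [chinese_seq] yields [a]. *)
Lemma beta_surj (u : nat -> nat) n :
  exists a b, forall i, i <= n -> beta a b i = u i.
Proof.
pose N := maxn n (\max_(i < n.+1) u i).
have dvdN k : 0 < k <= n -> k %| N`!.
  move=> /andP[k0 kn]; apply: dvdn_fact.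
  by rewrite k0 (leq_trans kn)// leq_maxl.
pose d i := (i.+1 * N`!).+1.
have [|a aP] := @chinese_seq d u n.+1.
  move=> i j /andP[ij jn]; rewrite /coprime -dvdn1.
  set g := gcdn _ _.
  have gi : g %| d i by apply: dvdn_gcdl.
  have gj : g %| d j by apply: dvdn_gcdr.
  (* The common divisor [g] is coprime to the factorial, hence divides [j - i], which itself divides
     the factorial; so [g] is 1. *)
  have co_gN : coprime g N`!.
    by apply: coprime_dvdl gi _; rewrite /d -addn1 coprime_sym /coprime gcdnMDl gcdn1.
  have g_ji : g %| j - i.
    rewrite -(Gauss_dvdl _ co_gN).
    have -> : (j - i) * N`! = d j - d i by rewrite /d subSS -mulnBl subSS.
    exact: dvdn_sub.
  have gN : g %| N`!.
    by apply: dvdn_trans g_ji (dvdN _ _); rewrite subn_gt0 ij (leq_trans (leq_subr _ _)).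
  have := dvdn_mull i.+1 gN.
  by move: gi; rewrite /d -addn1 => gi gm; rewrite -(dvdn_addr _ gm).
exists a, N`! => i lt_in; rewrite /beta aP// modn_small// ltnS.
have uN : u i <= N.
  rewrite leq_max; apply/orP; right.
  exact: (@leq_bigmax _ (fun i : 'I_n.+1 => u i) (Ordinal (lt_in : i < n.+1))).
by rewrite mulSn (leq_trans uN)// (leq_trans (fact_geq N))// leq_addr.
Qed.

(** Trades the remainder for equations between polynomials; [r] witnesses that [v] is below the
    modulus. *)
Lemma betaP a b i v :
  beta a b i = v <-> exists q r, a = q * (i.+1 * b).+1 + v /\ v + r = i.+1 * b.
Proof.
rewrite /beta; split=> [<-|[q [r [-> vr]]]].
  exists (a %/ (i.+1 * b).+1), (i.+1 * b - a %% (i.+1 * b).+1).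
  by rewrite -divn_eq subnKC// -ltnS ltn_mod.
by rewrite modnMDl modn_small// ltnS -vr leq_addr.
Qed.

(** Unlike Cantor's pairing it involves no halving, so it is directly a term; it is injective but
    not onto. *)
Definition code_pair x y := (x + y) * (x + y) + x.

(** The code lies in [[(x + y)^2, (x + y + 1)^2[], so it determines [x + y], and then [x]. *)
Lemma code_pair_inj x y x' y' :
  code_pair x y = code_pair x' y' -> x = x' /\ y = y'.
Proof.
rewrite /code_pair => e.
suff s_eq : x + y = x' + y' by rewrite s_eq in e; lia.
by have [] := ltngtP (x + y) (x' + y') => // lt_s; nia.
Qed.

End Beta.

(** * Definable relations and their closure properties *)

Section Definability.
Local Open Scope nat_scope.

Lemma teval_eq_in xi xi' t : {in tfv t, xi =1 xi'} -> teval xi t = teval xi' t.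
Proof.
elim: t => [x|//|t IHt|t IHt s IHs|t IHt s IHs] /= e; first exact/e/mem_head.
- by rewrite IHt.
- by rewrite IHt ?IHs// => x xs; apply: e; rewrite mem_cat xs ?orbT.
- by rewrite IHt ?IHs// => x xs; apply: e; rewrite mem_cat xs ?orbT.
Qed.

Lemma exists_fresh (ts : seq term) : exists N, forall z xi i, N <= z ->
  map (teval [eta xi with z |-> i]) ts = map (teval xi) ts.
Proof.
elim: ts => [|t ts [N NP]]; first by exists 0.
exists (maxn N (\max_(x <- tfv t) x).+1) => z xi i.
rewrite geq_max => /andP[/NP e tz] /=; rewrite e; congr cons.
apply: teval_eq_in => x xt /=; case: eqP => // xz.
suff: x <= \max_(y <- tfv t) y by rewrite {1}xz leqNgt tz.
exact: (@leq_bigmax_seq _ (tfv t) predT id).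
Qed.

Variables (R : realType) (mu : probability bitstream R).

(** Arguments form a list read by position, much like de Bruijn indices. *)
Definition polynomial (p : seq nat -> nat) :=
  forall ts, exists t, forall xi, teval xi t = p (map (teval xi) ts).

Definition polynomials (p : seq nat -> seq nat) :=
  forall ts, exists us, forall xi, map (teval xi) us = p (map (teval xi) ts).

(* Quantifying over the terms put for the arguments makes this notion closed
   under substitution, with no renaming of bound variables. *)
Definition definable (P : seq nat -> (nat -> bool) -> Prop) :=
  forall ts, exists F, forall xi w,
    interp mu xi F w <-> P (map (teval xi) ts) w.

Lemma polynomials_id : polynomials id.
Proof. by move=> ts; exists ts. Qed.

Lemma polynomials_behead p : polynomials p -> polynomials (fun s => behead (p s)).
Proof.
move=> pP ts; have [us e] := pP ts; exists (behead us) => xi.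
by rewrite -e; case: us {e}.
Qed.

Lemma polynomials_cons p q :
  polynomial p -> polynomials q -> polynomials (fun s => p s :: q s).
Proof.
move=> pP qP ts; have [t e] := pP ts; have [us e'] := qP ts.
by exists (t :: us) => xi /=; rewrite e e'.
Qed.

Lemma polynomial_nth p i : polynomials p -> polynomial (fun s => nth 0 (p s) i).
Proof.
(* Out of range, [TZero] evaluates to the default 0. *)
move=> pP ts; have [us e] := pP ts; exists (nth TZero us i) => xi.
rewrite -e; case: (ltnP i (size us)) => iu; first by rewrite (nth_map TZero).
by rewrite !nth_default ?size_map.
Qed.

Lemma polynomial_const n : polynomial (fun=> n).
Proof. by move=> ts; exists (numeral n) => xi; elim: n => //= n ->. Qed.

Lemma polynomial_add p q :
  polynomial p -> polynomial q -> polynomial (fun s => p s + q s).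
Proof.
move=> pP qP ts; have [t e] := pP ts; have [u e'] := qP ts.
by exists (TAdd t u) => xi /=; rewrite e e'.
Qed.

Lemma polynomial_mul p q :
  polynomial p -> polynomial q -> polynomial (fun s => p s * q s).
Proof.
move=> pP qP ts; have [t e] := pP ts; have [u e'] := qP ts.
by exists (TMul t u) => xi /=; rewrite e e'.
Qed.

Lemma polynomial_succ p : polynomial p -> polynomial (fun s => (p s).+1).
Proof.
by move=> pP ts; have [t e] := pP ts; exists (TSucc t) => xi /=; rewrite e.
Qed.

Lemma polynomial_code_pair p q : polynomial p -> polynomial q ->
  polynomial (fun s => code_pair (p s) (q s)).
Proof.
move=> pP qP; apply: polynomial_add => //.
by apply: polynomial_mul; apply: polynomial_add.
Qed.

Lemma eq_definable P Q :
  (forall s w, P s w <-> Q s w) -> definable P -> definable Q.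
Proof.
move=> PQ PP ts; have [F e] := PP ts; exists F => xi w.
by rewrite -PQ.
Qed.

Lemma definable_subst P p :
  definable P -> polynomials p -> definable (fun s => P (p s)).
Proof.
move=> PP pP ts; have [us e] := pP ts; have [F e'] := PP us.
by exists F => xi w; rewrite -e.
Qed.

Lemma definable_eq p q :
  polynomial p -> polynomial q -> definable (fun s _ => p s = q s).
Proof.
move=> pP qP ts; have [t e] := pP ts; have [u e'] := qP ts.
by exists (FEq t u) => xi w /=; rewrite -e -e'.
Qed.

Lemma definable_flip p : polynomial p -> definable (fun s w => w (p s)).
Proof.
by move=> pP ts; have [t e] := pP ts; exists (FFlip t) => xi w /=; rewrite -e.
Qed.

Lemma definable_not P : definable P -> definable (fun s w => ~ P s w).
Proof.
move=> PP ts; have [F e] := PP ts.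
by exists (FNot F) => xi w /=; rewrite -e.
Qed.

Lemma definable_and P Q :
  definable P -> definable Q -> definable (fun s w => P s w /\ Q s w).
Proof.
move=> PP QP ts; have [F e] := PP ts; have [G e'] := QP ts.
by exists (FAnd F G) => xi w /=; rewrite -e -e'.
Qed.

Lemma definable_or P Q :
  definable P -> definable Q -> definable (fun s w => P s w \/ Q s w).
Proof.
move=> PP QP ts; have [F e] := PP ts; have [G e'] := QP ts.
by exists (FOr F G) => xi w /=; rewrite -e -e'.
Qed.

(** The bound value becomes argument 0 and the others shift by one. Its variable [z] is fresh for
    [ts], so updating [z] leaves the other arguments unchanged. *)
Lemma definable_ex (P : nat -> seq nat -> (nat -> bool) -> Prop) :
  definable (fun s w => P (nth 0 s 0) (behead s) w) ->
  definable (fun s w => exists i, P i s w).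
Proof.
move=> PP ts; have [z zP] := exists_fresh ts.
have [F e] := PP (TVar z :: ts).
exists (FEx z F) => xi w /=; split.
  by move=> [i _ /e]; rewrite /= zP// eqxx; exists i.
by move=> [i Pi]; exists i => //; apply/e; rewrite /= zP// eqxx.
Qed.

Lemma definable_all (P : nat -> seq nat -> (nat -> bool) -> Prop) :
  definable (fun s w => P (nth 0 s 0) (behead s) w) ->
  definable (fun s w => forall i, P i s w).
Proof.
move=> /definable_not PP.
apply: (@eq_definable (fun s w => ~ exists i, ~ P i s w)) => [s w|].
  split=> [H i|H [i /(_ (H i))//]].
  by apply: contrapT => nP; apply: H; exists i.
by apply: definable_not; apply: definable_ex.
Qed.

Lemma definable_imp P Q :
  definable P -> definable Q -> definable (fun s w => P s w -> Q s w).
Proof.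
move=> PP QP; apply: (@eq_definable (fun s w => ~ P s w \/ Q s w)).
  by move=> s w; split=> [[]//|PQ]; have [/PQ|] := pselect (P s w); [right|left].
by apply: definable_or => //; apply: definable_not.
Qed.

(** [A] is decided outside the logic; this serves for facts about the machine, such as a state being
    final. *)
Lemma definable_cst (A : Prop) : definable (fun _ _ => A).
Proof.
move=> ts; have [AT|AF] := pselect A.
  by exists (FEq TZero TZero) => xi w; split.
by exists (FNot (FEq TZero TZero)) => xi w /=; split=> // /(_ erefl).
Qed.

(** Unrolled into a finite disjunction, so [P i] may depend on [i] in an arbitrary way. *)
Lemma definable_exfin (I : finType)
    (P : I -> seq nat -> (nat -> bool) -> Prop) :
  (forall i, definable (P i)) -> definable (fun s w => exists i, P i s w).
Proof.
move=> PP.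
apply: (@eq_definable (fun s w => exists2 i, i \in enum I & P i s w)).
  by move=> s w; split=> -[i]; exists i; rewrite // mem_enum.
elim: (enum I) => [|i r IHr].
  by apply: (eq_definable _ (definable_cst False)) => s w; split=> // -[].
apply: (eq_definable _ (definable_or (PP i) IHr)) => s w; split.
  by case=> [Pi|[j jr Pj]]; [exists i|exists j] => //; rewrite inE ?eqxx ?jr ?orbT.
move=> [j]; rewrite inE => /orP[/eqP ->|jr] Pj; first by left.
by right; exists j.
Qed.

End Definability.

Ltac polynomiality :=
  repeat first
    [ apply: polynomial_nth | apply: polynomial_succ | apply: polynomial_code_pair
    | apply: polynomial_add | apply: polynomial_mul
    | apply: polynomial_const | apply: polynomials_cons
    | apply: polynomials_behead | apply: polynomials_id ].

(** * Order, the beta function and finite sequences inside the logic *)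

Section Chain.
Local Open Scope nat_scope.
Variables (R : realType) (mu : probability bitstream R).
Notation definable := (definable mu).

Lemma definable_lt p q :
  polynomial p -> polynomial q -> definable (fun s _ => p s < q s).
Proof.
move=> pP qP.
(* Only projections occur under the quantifier, where arguments are shifted; [p] and [q] are
   substituted afterwards. *)
have lt2 : definable (fun s _ => exists i, (nth 0 s 0).+1 + i = nth 0 s 1).
  by apply: definable_ex; apply: definable_eq; polynomiality.
have := definable_subst lt2 (polynomials_cons pP (polynomials_cons qP polynomials_id)).
apply: eq_definable => s w /=; split=> [[i <-]|pq]; first exact: leq_addr.
by exists (q s - (p s).+1); rewrite subnKC.
Qed.

Lemma definable_beta a b i v :
  polynomial a -> polynomial b -> polynomial i -> polynomial v ->
  definable (fun s _ => beta (a s) (b s) (i s) = v s).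
Proof.
move=> aP bP iP vP.
have beta4 : definable (fun s _ =>
    beta (nth 0 s 0) (nth 0 s 1) (nth 0 s 2) = nth 0 s 3).
  apply: (eq_definable (fun s w => iff_sym (betaP _ _ _ _))).
  apply: definable_ex; apply: definable_ex.
  by apply: definable_and; apply: definable_eq; polynomiality.
apply: (definable_subst beta4 (p := fun s => [:: a s, b s, i s, v s & s])).
by do ![apply: polynomials_cons => //]; apply: polynomials_id.
Qed.

(** By [beta_surj], a finite sequence can be quantified over as a pair of numbers. The list holds
    the number of steps, the first value, the last value, then the parameters. *)
Lemma definable_chain (T : nat -> nat -> nat -> seq nat -> (nat -> bool) -> Prop) :
  definable (fun s => T (nth 0 s 0) (nth 0 s 1) (nth 0 s 2) (drop 3 s)) ->
  definable (fun s w => exists u : nat -> nat, [/\ u 0 = nth 0 s 1,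
    u (nth 0 s 0) = nth 0 s 2 &
    forall i, i < nth 0 s 0 -> T i (u i) (u i.+1) (drop 3 s) w]).
Proof.
move=> TP.
apply: (@eq_definable _ _ (fun s w => exists a b : nat,
   beta a b 0 = nth 0 s 1 /\ (beta a b (nth 0 s 0) = nth 0 s 2 /\
   forall i, i < nth 0 s 0 -> exists x y, beta a b i = x /\
      (beta a b i.+1 = y /\ T i x y (behead (behead (behead s))) w)))).
  move=> s w; have dE : behead (behead (behead s)) = drop 3 s.
    by case: s => [|? [|? [|? ?]]] //=; rewrite drop0.
  rewrite dE; split=> [[a [b [e0 [en H]]]]|[u [u0 un H]]].
    exists (beta a b); split=> // i /H [x [y [-> [-> ]]]] //.
  have [a [b ab]] := beta_surj u (nth 0 s 0).
  exists a, b; rewrite !ab//; split=> //; split=> // i lt_in.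
  by exists (u i), (u i.+1); rewrite !ab// 1?ltnW//; split=> //; split=> //; apply: H.
apply: definable_ex; apply: definable_ex; apply: definable_and.
  by apply: definable_beta; polynomiality.
apply: definable_and; first by apply: definable_beta; polynomiality.
apply: definable_all; apply: definable_imp; first by apply: definable_lt; polynomiality.
apply: definable_ex; apply: definable_ex; apply: definable_and.
  by apply: definable_beta; polynomiality.
apply: definable_and; first by apply: definable_beta; polynomiality.
(* The list now begins with the bound values [y, x, i, b, a]; eight tails skip these five and the
   three arguments of the chain. *)
apply: eq_definable (definable_subst TP (p := fun s =>
  [:: nth 0 (behead (behead s)) 0, nth 0 (behead s) 0, nth 0 s 0 &
    behead (behead (behead (behead (behead (behead (behead (behead s)))))))]) _).
  by move=> s w /=; rewrite drop0.
by polynomiality.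
Qed.

End Chain.

(** * Arithmetical coding of tapes, steps and runs *)

Section Machine.
Local Open Scope nat_scope.
Variables (R : realType) (mu : probability bitstream R) (M : ptm).
Notation definable := (definable mu).
Notation blank := (ptm_blank M).

Definition code_base := #|ptm_symbol M|.+1.

(* The blank gets code 0, so that words differing by trailing blanks have the
   same code. *)
Definition code_symbol (a : ptm_symbol M) :=
  index a (blank :: enum (ptm_symbol M)).

(** Digits in base [code_base], lowest first; [n] codes what follows [v]. *)
Definition code_word (v : seq (ptm_symbol M)) n :=
  foldr (fun a k => code_symbol a + code_base * k) n v.

Definition code_state (q : ptm_state M) : nat := enum_rank q.

(** The scanned symbol is the lowest digit of the right half. *)
Definition code_config (c : config M) :=
  let: Config q l a r := c in
  code_pair (code_state q) (code_pair (code_word l 0) (code_word (a :: r) 0)).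

Lemma code_symbolK :
  cancel code_symbol (nth blank (blank :: enum (ptm_symbol M))).
Proof. by move=> a; apply: nth_index; rewrite inE mem_enum orbT. Qed.

Lemma code_symbol_inj : injective code_symbol.
Proof. exact: can_inj code_symbolK. Qed.

Lemma code_symbol_lt a : code_symbol a < code_base.
Proof.
rewrite /code_base cardE /code_symbol -[(size _).+1]/(size (blank :: _)) index_mem.
by rewrite inE mem_enum orbT.
Qed.

Lemma code_symbol_blank : code_symbol blank = 0.
Proof. by rewrite /code_symbol /= eqxx. Qed.

Lemma code_symbol_eq a b k n :
  code_symbol a + code_base * k = code_symbol b + code_base * n -> a = b /\ k = n.
Proof.
rewrite ![_ + code_base * _]addnC ![code_base * _]mulnC => e.
have /(congr1 (edivn^~ code_base)) := e.
by rewrite !edivn_eq ?code_symbol_lt// => -[-> /code_symbol_inj].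
Qed.

(** The empty word is no exception: the blank read there has digit 0. *)
Lemma code_word_head v :
  code_word v 0 = code_symbol (head blank v) + code_base * code_word (behead v) 0.
Proof. by case: v => //=; rewrite code_symbol_blank muln0. Qed.

(** Moving left splits the lowest digit off [L]; moving right splits nothing, since the next symbol
    is already the lowest digit of [k]. *)
Definition code_step_to q a (d : move) L k y :=
  match d with
  | MoveLeft => exists a' L', L = code_symbol a' + code_base * L' /\
      y = code_pair (code_state q) (code_pair L'
            (code_symbol a' + code_base * (code_symbol a + code_base * k)))
  | Stay =>
      y = code_pair (code_state q) (code_pair L (code_symbol a + code_base * k))
  | MoveRight =>
      y = code_pair (code_state q) (code_pair (code_symbol a + code_base * L) k)
  end.

Definition code_step (b : bool) x y := exists q a L k,
  x = code_pair (code_state q) (code_pair L (code_symbol a + code_base * k)) /\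
  (if q \in ptm_final M then y = x else
    let p := ptm_trans q a in
    let: (q', a', d) := if b then p.2 else p.1 in code_step_to q' a' d L k y).

(** Pairing and base expansion are injective, so the code of [c] fixes the state, the scanned symbol
    and both halves of the tape. *)
Lemma code_stepP b c y : code_step b (code_config c) y <->
  y = code_config (step b c).
Proof.
case: c => q l a r; split.
  move=> [q' [a' [L [k [/code_pair_inj[/ord_inj/enum_rank_inj <-]]]]]].
  move=> /code_pair_inj[<-] /code_symbol_eq[<- <-].
  rewrite /step /is_final /=; case: (q \in _) => //.
  case: (if b then _ else _) => -[q1 a1] [] //=.
    by move=> [a0 [L']]; rewrite code_word_head => -[/code_symbol_eq[<- <-]] ->.
  by move=> ->; rewrite -code_word_head.
move=> ->; exists q, a, (code_word l 0), (code_word r 0); split=> //.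
rewrite /step /is_final /=; case: (q \in _) => //.
case: (if b then _ else _) => -[q1 a1] [] //=.
  by exists (head blank l), (code_word (behead l) 0); rewrite -code_word_head.
by rewrite -code_word_head.
Qed.

Lemma definable_code_step : definable (fun s w =>
  code_step (w (nth 0 s 0)) (nth 0 s 1) (nth 0 s 2)).
Proof.
(* For a fixed coin value the transition table is unrolled over all states and symbols; FLIP then
   selects the value. *)
have stepP b : definable (fun s _ => code_step b (nth 0 s 1) (nth 0 s 2)).
  apply: definable_exfin => q; apply: definable_exfin => a.
  apply: definable_ex; apply: definable_ex.
  apply: definable_and; first by apply: definable_eq; polynomiality.
  case: (q \in _) => /=; first by apply: definable_eq; polynomiality.
  case: (if b then _ else _) => -[q1 a1] [] /=.
  - apply: definable_exfin => a0; apply: definable_ex.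
    by apply: definable_and; apply: definable_eq; polynomiality.
  - by apply: definable_eq; polynomiality.
  - by apply: definable_eq; polynomiality.
have flip : definable (fun s w => w (nth 0 s 0)).
  by apply: definable_flip; polynomiality.
apply: (eq_definable _ (definable_or (definable_and flip (stepP true))
  (definable_and (definable_not flip) (stepP false)))) => s w.
by case: (w (nth 0 s 0)); split=> [[[]|[]]|]//; [left|right].
Qed.

(** The block has variable length, so its code is reached by a chain that prepends one digit [a] at
    each step. *)
Lemma definable_code_nseq a n p q :
  polynomial n -> polynomial p -> polynomial q ->
  definable (fun s _ => q s = code_word (nseq (n s) a) (p s)).
Proof.
move=> nP pP qP.
have chainP : definable (fun s w => exists u : nat -> nat, [/\ u 0 = nth 0 s 1,
    u (nth 0 s 0) = nth 0 s 2 &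
    forall i, i < nth 0 s 0 -> u i.+1 = code_symbol a + code_base * u i]).
  apply: (definable_chain (T := fun _ x y _ _ => y = code_symbol a + code_base * x)).
  by apply: definable_eq; polynomiality.
have pqP : polynomials (fun s => [:: n s, p s, q s & s]).
  by do ![apply: polynomials_cons => //]; apply: polynomials_id.
apply: (eq_definable _ (definable_subst chainP pqP)) => s w /=.
split=> [[u [<- <- ]]|->].
  elim: (n s) => //= k IHk uS; rewrite uS// IHk// => i ik.
  by apply: uS; apply: ltnW.
by exists (fun i => code_word (nseq i a) (p s)).
Qed.

Notation bit := (@ptm_bit M).

Lemma code_word_cat v1 v2 n :
  code_word (v1 ++ v2) n = code_word v1 (code_word v2 n).
Proof. by rewrite /code_word foldr_cat. Qed.

Lemma code_encode n v k :
  code_word (map bit (encode (n :: v))) k =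
  code_word (nseq n (bit true)) (code_symbol (bit false) +
    code_base * code_word (map bit (encode v)) k).
Proof.
by rewrite /encode /= map_cat code_word_cat map_rcons -cats1 code_word_cat map_nseq.
Qed.

(** The number of components is fixed by [js] outside the logic, so induction on [js] suffices; only
    the blocks of ones need a chain. *)
Lemma definable_encode q p (js : seq nat) :
  polynomial q -> polynomials p -> definable (fun s _ =>
    q s = code_word (map bit (encode [seq nth 0 (p s) j | j <- js])) 0).
Proof.
move=> qP pP.
have encP : definable (fun s _ => nth 0 s 0 =
    code_word (map bit (encode [seq nth 0 (behead s) j | j <- js])) 0).
  elim: js => [|j js IHjs]; first by apply: definable_eq; polynomiality.
  apply: (@eq_definable _ _ (fun s _ => exists v, v = code_word
      (map bit (encode [seq nth 0 (behead s) j | j <- js])) 0 /\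
      nth 0 s 0 = code_word (nseq (nth 0 (behead s) j) (bit true))
        (code_symbol (bit false) + code_base * v))).
    move=> s w; rewrite code_encode.
    by split=> [[_ [-> ]]//|->]; eexists; split.
  apply: definable_ex; apply: definable_and.
    (* Argument 0 is now [v], in place of the code of the whole tuple, which is skipped. *)
    have tailP : polynomials (fun s => nth 0 s 0 :: behead (behead s)).
      by polynomiality.
    exact: (definable_subst IHjs tailP).
  by apply: definable_code_nseq; polynomiality.
apply: (definable_subst encP (p := fun s => q s :: p s)).
exact: polynomials_cons.
Qed.

(** A multiple of [code_base] has lowest digit 0, which is the blank; if [w] stops right after [v],
    the missing cells count as digits 0 too. *)
Lemma take_index_blankP v w : blank \notin v ->
  take (index blank w) w = v <-> exists z, code_word w 0 = code_word v (code_base * z).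
Proof.
elim: v w => [|a v IHv] w.
  move=> _; split=> [|[z]].
    case: w => [|b w] /=; first by exists 0; rewrite muln0.
    by case: eqP => // -> _; exists (code_word w 0); rewrite code_symbol_blank.
  rewrite code_word_head /= -[code_base * z]add0n -code_symbol_blank.
  by move=> /code_symbol_eq[+ _]; case: w => //= b w ->; rewrite eqxx.
rewrite inE negb_or => /andP[ab /IHv{}IHv]; split=> [|[z]].
  case: w => [|b w] //=; case: eqP => //= _ [<- /IHv[z ->]].
  by exists z.
rewrite code_word_head /= => /code_symbol_eq[e e'].
case: w e e' => [|b w] /= ba e; first by rewrite ba eqxx in ab.
by rewrite ba eq_sym (negbTE ab) /=; congr cons; apply/IHv; exists z.
Qed.

(** From the code of a configuration [code_step] leaves no choice, so the chain is forced to be the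
    run. *)
Lemma run_chainP ns w t y :
  (exists u : nat -> nat, [/\ u 0 = code_config (init_config M ns), u t = y &
     forall i, i < t -> code_step (w i) (u i) (u i.+1)]) <->
  y = code_config (run M ns w t).
Proof.
split=> [[u [u0 <- ]]|->].
  elim: t => [|t IHt] uS; first exact: u0.
  apply/code_stepP; rewrite -IHt; first exact: uS.
  by move=> i it; apply: uS; apply: ltnW.
exists (fun i => code_config (run M ns w i)); split=> // i _.
exact/code_stepP.
Qed.

(** After the [l] ones come the closing bit and a blank, whence the two factors [code_base]; [z] is
    the tape beyond that blank. *)
Lemma acceptingP c l :
  is_final c /\ output_word c = map bit (encode [:: l]) <->
  exists q L W, code_config c = code_pair (code_state q) (code_pair L W) /\
    (q \in ptm_final M /\ exists z, W = code_word (nseq l (bit true))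
      (code_symbol (bit false) + code_base * (code_base * z))).
Proof.
have nblank : blank \notin map bit (encode [:: l]).
  apply/mapP => -[b _ /eqP]; rewrite eq_sym; apply/negP; exact: ptm_bit_nblank.
case: c => q a h r; rewrite /is_final /output_word take_index_blankP//.
have codeE z : code_word (map bit (encode [:: l])) (code_base * z) =
    code_word (nseq l (bit true)) (code_symbol (bit false) + code_base * (code_base * z)).
  by rewrite code_encode.
split=> [[qf [z e]]|[q' [L [W [/code_pair_inj[/ord_inj/enum_rank_inj <-]]]]]].
  exists q, (code_word a 0), (code_word (h :: r) 0); split=> //; split=> //.
  by exists z; rewrite -codeE.
by move=> /code_pair_inj[_ <-] [qf [z e]]; split=> //; exists z; rewrite codeE.
Qed.

Lemma definable_halts_with m : definable (fun s w =>
  halts_with M [seq nth 0 s j | j <- iota 0 m] (nth 0 s m) w).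
Proof.
set ns := fun s => [seq nth 0 s j | j <- iota 0 m].
(* [W] codes the input, [t] is a halting time and [y] the configuration at time [t]. *)
apply: (@eq_definable _ _ (fun s w => exists W t y,
  (W = code_word (map bit (encode (ns s))) 0 /\
   exists u : nat -> nat, [/\ u 0 = code_pair (code_state (ptm_start M)) (code_pair 0 W),
     u t = y & forall i, i < t -> code_step (w i) (u i) (u i.+1)]) /\
  exists q L W', y = code_pair (code_state q) (code_pair L W') /\
    (q \in ptm_final M /\ exists z, W' = code_word (nseq (nth 0 s m) (bit true))
      (code_symbol (bit false) + code_base * (code_base * z))))).
  move=> s w.
  (* For [m = 0] the input word is empty and the head reads a blank, still coded by [W = 0]. *)
  have initE : code_config (init_config M (ns s)) =
      code_pair (code_state (ptm_start M))
        (code_pair 0 (code_word (map bit (encode (ns s))) 0)).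
    by rewrite /= [in RHS]code_word_head.
  split=> [[W [t [y [[-> ]]]]]|[t]].
    by rewrite -initE run_chainP => -> /acceptingP; exists t.
  move=> /acceptingP acc; exists (code_word (map bit (encode (ns s))) 0), t.
  by eexists; split; [split=> //; rewrite -initE; apply/run_chainP|exact: acc].
do 3!apply: definable_ex.
apply: definable_and; first apply: definable_and.
- by apply: definable_encode; polynomiality.
- have chainP := @definable_chain _ mu (fun i x y _ w => code_step (w i) x y)
    definable_code_step.
  apply: (definable_subst chainP (p := fun s => [:: nth 0 (behead s) 0,
    code_pair (code_state (ptm_start M)) (code_pair 0 (nth 0 (behead (behead s)) 0)),
    nth 0 s 0 & s])).
  by polynomiality.
apply: definable_exfin => q; do 2!apply: definable_ex.
apply: definable_and; first by apply: definable_eq; polynomiality.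
apply: definable_and; first exact: definable_cst.
by apply: definable_ex; apply: definable_code_nseq; polynomiality.
Qed.

End Machine.

(** * Substitution of numerals and adjustment of free variables *)

Section Instantiation.
Local Open Scope nat_scope.
Variables (R : realType) (mu : probability bitstream R).

Lemma teval_tsubst xi x n t :
  teval xi (tsubst x (numeral n) t) = teval [eta xi with x |-> n] t.
Proof.
elim: t => [y||t /= ->|t /= -> s ->|t /= -> s ->] //=.
by case: eqP => //= _; elim: n => //= n ->.
Qed.

(** Numerals are closed, so nothing is captured: updates at distinct variables commute, and a
    quantifier over [x] itself overrides the update. *)
Lemma interp_fsubst xi x n F :
  interp mu xi (fsubst x (numeral n) F) = interp mu [eta xi with x |-> n] F.
Proof.
have updC y i (xi1 : nat -> nat) : y != x ->
    [eta [eta xi1 with y |-> i] with x |-> n] =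
    [eta [eta xi1 with x |-> n] with y |-> i] :> (nat -> nat).
  move=> yx; apply/funext => z /=.
  by have [->|//] := eqVneq z x; rewrite eq_sym (negbTE yx).
have updK i (xi1 : nat -> nat) :
    [eta [eta xi1 with x |-> n] with x |-> i] = [eta xi1 with x |-> i]
      :> (nat -> nat).
  by apply/funext => z /=; case: eqP.
elim: F xi => [t|t s|G IG|G IG H IH|G IG H IH|y G IG|y G IG|t s G IG|t s G IG]
  xi /=; rewrite ?teval_tsubst ?IG ?IH //.
- apply: eq_bigcupr => i _; have [->|yx] := eqVneq y x; first by rewrite updK.
  by rewrite IG updC.
- apply: eq_bigcapr => i _; have [->|yx] := eqVneq y x; first by rewrite updK.
  by rewrite IG updC.
Qed.

Lemma interp_instantiate xi F ns :
  interp mu xi (instantiate F ns) = interp mu (fun x => nth (xi x) ns x) F.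
Proof.
rewrite /instantiate.
(* The first substituted variable, here 0, has to be general for the induction on [ns]. *)
have -> : (fun x => nth (xi x) ns x) =
    (fun x => if x < 0 then xi x else nth (xi x) ns (x - 0)).
  by apply/funext => x; rewrite subn0.
elim: ns 0 F => [|n ns IHns] k F /=.
  by congr interp; apply/funext => x; rewrite nth_nil if_same.
rewrite IHns interp_fsubst; congr interp; apply/funext => x /=.
rewrite ltnS; have [//|kx|->] := ltngtP x k.
  by rewrite -[in RHS](subnSK kx).
by rewrite subnn.
Qed.

Lemma fv_exists_vars F vs x :
  (x \in fv (foldr FEx F vs)) = (x \in fv F) && (x \notin vs).
Proof.
elim: vs => [|v vs IHvs] /=; first by rewrite andbT.
by rewrite mem_filter IHvs inE negb_or andbCA.
Qed.

(** Each quantifier is vacuous: it takes the union of a constant family over a nonempty index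
    set. *)
Lemma interp_exists_vars (A : (nat -> nat) -> set bitstream) vs F :
  (forall xi v i, v \in vs -> A [eta xi with v |-> i] = A xi) ->
  (forall xi, interp mu xi F = A xi) ->
  forall xi, interp mu xi (foldr FEx F vs) = A xi.
Proof.
move=> + FA; elim: vs => [|v vs IHvs] Avs xi //=.
have e i : interp mu [eta xi with v |-> i] (foldr FEx F vs) = A xi.
  rewrite IHvs => [|xi' v' i' v'vs]; first by rewrite Avs// mem_head.
  by apply: Avs; rewrite inE v'vs orbT.
by rewrite (eq_bigcupr (fun i _ => e i)) bigcup_const.
Qed.

(** Trivially true equations add free variables without changing the denotation. *)
Definition mention_vars F vs := foldr (fun x => FAnd (FEq (TVar x) (TVar x))) F vs.

Lemma fv_mention_vars F vs x :
  (x \in fv (mention_vars F vs)) = (x \in fv F) || (x \in vs).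
Proof.
elim: vs => [|v vs IHvs] /=; first by rewrite orbF.
by rewrite !inE IHvs orbA orbb orbCA.
Qed.

Lemma interp_mention_vars F vs xi :
  interp mu xi (mention_vars F vs) = interp mu xi F.
Proof.
elim: vs => //= v vs ->; apply/seteqP.
by split=> [w []|w] //; split.
Qed.

(** [definable] does not control free variables: those from [k] on are bound vacuously, and those
    below [k] are then all mentioned. *)
Lemma definable_formula k P : definable mu P -> exists F,
  (forall x, (x \in fv F) = (x < k)) /\
  forall xi w, interp mu xi F w <-> P (mkseq xi k) w.
Proof.
move=> PP; have [F FP] := PP (mkseq TVar k).
pose vs := [seq x <- fv F | k <= x].
exists (mention_vars (foldr FEx F vs) (iota 0 k)); split=> [x|xi w].
  rewrite fv_mention_vars fv_exists_vars mem_filter mem_iota /= add0n leqNgt.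
  by case: (x < k); rewrite ?orbT //= orbF; case: (x \in _).
rewrite interp_mention_vars.
rewrite (@interp_exists_vars (fun xi => P (mkseq xi k))) => [//|xi' v i|xi'].
  rewrite mem_filter => /andP[kv _]; congr P; apply/eq_in_map => x.
  by rewrite mem_iota /= => xk; case: eqP => // xv; lia.
apply/funext => w'; apply/propext; rewrite FP.
by rewrite -[map _ _]map_comp.
Qed.

End Instantiation.

Theorem theorem3 (R : realType) (mu : probability bitstream R)
    (mu_coin : is_coin_measure mu) (m : nat) (f : random_function R m)
    (f_computable : computable mu f) :
  exists F : formula,
    (forall x : nat, (x \in fv F) = (x < m.+1)%N) /\
    forall (ns : m.-tuple nat) (l : nat) (xi : nat -> nat),
      mu (interp mu xi (instantiate F (rcons ns l))) = (f ns l)%:E.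
Proof.
have [M Mf] := f_computable.
have [F [Ffv FP]] := definable_formula m.+1 (definable_halts_with mu M m).
(* Both sides become measures of events, and the events themselves coincide. *)
exists F; split=> // ns l xi; rewrite Mf interp_instantiate; congr (mu _).
pose nl := rcons ns l.
(* The [m.+1] positions all lie within [nl], so the default [xi x] is never reached. *)
have nlE : mkseq (fun x => nth (xi x) nl x) m.+1 = nl.
  apply: (@eq_from_nth _ 0%N); rewrite ?size_mkseq ?size_rcons ?size_tuple// => i im.
  by rewrite nth_mkseq//; apply: set_nth_default; rewrite size_rcons size_tuple.
apply/funext => w; apply/propext; rewrite FP nlE /nl nth_rcons size_tuple ltnn eqxx.
suff -> : [seq nth 0%N (rcons ns l) j | j <- iota 0 m] = ns by [].
apply: (@eq_from_nth _ 0%N); rewrite ?size_map ?size_iota ?size_tuple// => i im.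
by rewrite (nth_map 0%N) ?size_iota// nth_iota// nth_rcons size_tuple im.
Qed.
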